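(* Let $(X,d)$ be a complete metric space with $|X|\geqslant 3$, let $k\in\mathbb{N}$ with $3\leqslant k\leqslant |X|$, and let $T\colon X\to X$ be a Kannan-type perimetric contraction on $k$-polygons in $X$ that has no periodic points of prime period $i$ for any $i\in\{2,3,\ldots,k-1\}$. Suppose that $T$ has a fixed point $w$ which is the limit of some iteration sequence $(x_i)_{i\geqslant 0}$, where $x_0\in X$ and $x_i=Tx_{i-1}$ for $i\geqslant 1$, such that $w\neq x_i$ for all $i\geqslant 0$. Then $w$ is the unique fixed point of $T$.
   Context: $|X|$ denotes the cardinality of $X$ (possibly infinite). For points $x_1,\ldots,x_k$ of a metric space $(X,d)$, $k\geqslant 3$, put $P(x_1,x_2,\ldots,x_k)=d(x_1,x_2)+d(x_2,x_3)+\cdots+d(x_{k-1},x_k)+d(x_k,x_1)$. For $3\leqslant k\leqslant|X|$, a map $T\colon X\to X$ is a Kannan-type perimetric contraction on $k$-polygons in $X$ if there exists $\mu\in[0,\frac{2}{k})$ such that $P(Tx_1,\ldots,Tx_k)\leqslant\mu\big(d(x_1,Tx_1)+d(x_2,Tx_2)+\cdots+d(x_k,Tx_k)\big)$ for all $k$ pairwise distinct points $x_1,\ldots,x_k\in X$. A point $x\in X$ is a periodic point of period $p$ if $T^p x=x$; its prime period is the least positive integer $p$ with $T^p x=x$. *)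

(* Defs.v *)
From HB Require Import structures.
From mathcomp Require Import all_boot all_order all_algebra.
From mathcomp Require Import all_classical all_reals all_analysis.

Set Implicit Arguments.
Unset Strict Implicit.
Unset Printing Implicit Defensive.

Import Order.TTheory GRing.Theory Num.Theory.

Local Open Scope classical_set_scope.
Local Open Scope ring_scope.

(* [Complete] includes a distinguished point, so the empty space is excluded. *)
#[short(type="completeMetricType")]
HB.structure Definition CompleteMetric (K : numDomainType) :=
  {M of Metric K M & Complete M}.

(* The indices 0, ..., k - 1 stand for 1, ..., k; [ordS] is the cyclic
   successor, so the term of index k - 1 is the closing side d(x_k, x_1). *)
Definition perimeter (R : realType) (X : metricType R) (k : nat)
    (x : 'I_k -> X) : R :=
  \sum_(i < k) mdist (x i) (x (ordS i)).

Definition kannan_perimetric_contraction (R : realType) (X : metricType R)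
    (k : nat) (T : X -> X) : Prop :=
  exists mu : R, 0 <= mu < 2 / k%:R /\
    forall x : 'I_k -> X, injective x ->
      perimeter (T \o x) <= mu * \sum_(i < k) mdist (x i) (T (x i)).

Definition periodic_point (X : Type) (T : X -> X) (p : nat) (x : X) : Prop :=
  iter p T x = x.

Definition prime_period (X : Type) (T : X -> X) (p : nat) (x : X) : Prop :=
  [/\ (0 < p)%N, periodic_point T p x
    & forall q : nat, (0 < q)%N -> periodic_point T q x -> (p <= q)%N].

Definition iteration_sequence (X : Type) (T : X -> X) (x : nat -> X) : Prop :=
  forall i : nat, (0 < i)%N -> x i = T (x i.-1).

(* Main.v *)
(* If v were a second fixed point, apply the contraction inequality to the
   polygon w, v, x_n, ..., x_(n+k-3).  Its image has w and v among its vertices,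
   hence perimeter at least d(w, v), while the right-hand side is mu times a sum
   of step lengths d(x_j, x_(j+1)), which tends to 0.  The vertices are distinct
   because a sequence of iterates that repeats a value visits it infinitely
   often and so could only converge to that value. *)
Require Import Defs.
From mathcomp Require Import all_boot all_order all_algebra.
From mathcomp Require Import all_classical all_reals all_analysis.
From mathcomp Require Import lra.

Set Implicit Arguments.
Unset Strict Implicit.
Unset Printing Implicit Defensive.

Import Order.TTheory GRing.Theory Num.Theory.

Local Open Scope classical_set_scope.
Local Open Scope card_scope.
Local Open Scope ring_scope.

Lemma iteration_sequenceD (X : Type) (T : X -> X) (x : nat -> X) (n m : nat) :
  iteration_sequence T x -> x (n + m)%N = iter m T (x n).
Proof.
move=> xT; elim: m => [|m IHm]; first by rewrite addn0.
by rewrite addnS xT //= IHm.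
Qed.

(** Each term determines the next, so the terms from index [i + p] on retrace those from index
    [i]. *)
Lemma iteration_sequence_repeat (X : Type) (T : X -> X) (x : nat -> X)
    (i p m : nat) : iteration_sequence T x ->
  x (i + p)%N = x i -> x (i + m * p)%N = x i.
Proof.
move=> xT xp; elim: m => [|m IHm]; first by rewrite mul0n addn0.
by rewrite mulSn addnA (iteration_sequenceD _ _ xT) xp
  -(iteration_sequenceD _ _ xT).
Qed.

Lemma cvg_iteration_sequence_inj (R : realType) (X : metricType R)
    (T : X -> X) (x : nat -> X) (w : X) :
  iteration_sequence T x -> x i @[i --> \oo] --> w ->
  (forall i, w <> x i) -> injective x.
Proof.
move=> xT xw wx.
have step i p : (0 < p)%N -> x (i + p)%N <> x i.
  move=> p0 xp; have wi0 : 0 < mdist w (x i) by rewrite mdist_gt0; apply/eqP.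
  have [N _ Nx] := metricType_numDomainType.cvgr_dist_lt xw wi0.
  (* Since [p] is positive, this index is at least [N], yet its term is again [x i], which is not
     closer to [w] than itself. *)
  have /Nx : (N <= i + N * p)%N.
    by rewrite (leq_trans (leq_pmulr N p0)) ?leq_addl.
  by rewrite /= (iteration_sequence_repeat _ xT xp) ltxx.
move=> i j xij; apply/eqP; rewrite eqn_leq; apply/andP.
split; rewrite leqNgt; apply/negP => ltij.
  by apply: (step j (i - j)%N); rewrite ?subn_gt0 // subnKC // ltnW.
by apply: (step i (j - i)%N); rewrite ?subn_gt0 // subnKC // ltnW.
Qed.

Lemma mdist_le_perimeter (R : realType) (X : metricType R) (k : nat)
    (x : 'I_k -> X) (i : 'I_k) : mdist (x i) (x (ordS i)) <= perimeter x.
Proof.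
by rewrite /perimeter (bigD1 i) //= lerDl sumr_ge0 // => j _; exact: mdist_ge0.
Qed.

Theorem proposition3p8 (R : realType) (X : completeMetricType R)
    (cardX : `I_3 #<= [set: X])
    (k : nat) (k_ge3 : (3 <= k)%N) (k_le : `I_k #<= [set: X])
    (T : X -> X) (T_kannan : kannan_perimetric_contraction k T)
    (T_period : forall i : nat, (2 <= i <= k.-1)%N ->
      ~ exists x : X, prime_period T i x)
    (w : X) (w_fixed : T w = w)
    (w_limit : exists x : nat -> X,
      [/\ iteration_sequence T x, x i @[i --> \oo] --> w
        & forall i : nat, w <> x i]) :
  T w = w /\ forall v : X, T v = v -> v = w.
Proof.
split=> // v v_fixed; apply/eqP/negPn/negP => vw.
have [x [xT xw wx]] := w_limit.
have [mu [/andP[mu0 muk] kannan]] := T_kannan.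
have x_inj := cvg_iteration_sequence_inj xT xw wx.
have xS i : T (x i) = x i.+1 by rewrite (xT i.+1).
have vx i : v <> x i.
  (* A fixed point on the sequence would make it stationary, against injectivity. *)
  move=> vi; suff /x_inj/esym/n_Sn : x i.+1 = x i by [].
  by rewrite -xS -vi.
set D := mdist w v.
have D0 : 0 < D by rewrite mdist_gt0 eq_sym.
(* Two consecutive terms within [D / 8] of [w] are less than [D / 4] apart; as [mu * k < 2], the
   right-hand side then stays below [D / 2]. *)
have e0 : 0 < D / 8 by lra.
have [N _ Nx] := metricType_numDomainType.cvgr_dist_lt xw e0.
(* The polygon is the first [k] terms of this infinite sequence, so distinctness is proved without
   reference to [k]. *)
pose y n := if n is n'.+1 then if n' is j.+1 then x (N + j)%N else v else w.
have y_inj : injective y.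
  move=> [|[|i]] [|[|j]] //= => [/esym/eqP|/wx|/eqP|/vx|/esym/wx|/esym/vx|] //.
  - by rewrite (negPf vw).
  - by rewrite (negPf vw).
  - by move=> /x_inj/addnI ->.
have step n : mdist (y n) (T (y n)) <= D / 4.
  case: n => [|[|j]] /=; rewrite ?w_fixed ?v_fixed ?mdistxx; [lra|lra|].
  rewrite xS (le_trans (metric_triangle _ w _)) // metric_sym.
  have /= h1 := Nx (N + j)%N (leq_addr _ _).
  have /= h2 := Nx (N + j).+1 (leqW (leq_addr _ _)).
  lra.
have k0 : (0 < k)%N by exact: ltn_trans k_ge3.
pose o := Ordinal k0.
have := kannan (y \o val) (inj_comp y_inj val_inj).
apply/negP; rewrite -ltNge.
apply: (@lt_le_trans _ _ D); last first.
  (* The image side of index 0 joins [T w = w] to [T v = v]; as [1 < k], the cyclic successor of 0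
     is 1. *)
  have := mdist_le_perimeter (T \o (y \o val)) o.
  by rewrite /= modn_small ?(ltn_trans _ k_ge3) //= w_fixed v_fixed.
have kR : 0 < k%:R :> R by rewrite ltr0n.
have sum_le : \sum_(i < k) mdist (y i) (T (y i)) <= k%:R * (D / 4).
  rewrite mulr_natl -[in leRHS](card_ord k) -sumr_const.
  by apply: ler_sum => i _; exact: step.
apply: (le_lt_trans (ler_wpM2l mu0 sum_le)).
have muk2 : mu * k%:R < 2 by rewrite -ltr_pdivlMr.
rewrite mulrA; nra.
Qed.
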